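(* Let $\mathcal{G}=(V,E)$ be an unweighted simple directed graph and let $\phi_1,\dots,\phi_l$ be spanning converging forests sampled independently and uniformly at random from the set $\mathcal{F}$ of all spanning converging forests of $\mathcal{G}$. For nodes $i,j$ define the estimator $$\overline{\omega}_{ij}=\begin{cases}\dfrac{1}{l}\displaystyle\sum_{t=1}^{l}\frac{1}{2+d_j}\Big(\widehat{\omega}_{ij}(\phi_t)+\sum_{k\in N^-_j}\widehat{\omega}_{ik}(\phi_t)\Big), & i\neq j,\\[3mm] \dfrac{1}{l}\displaystyle\sum_{t=1}^{l}\frac{1}{1+d_i}\Big(1+\sum_{k\in N^-_i}\widehat{\omega}_{ik}(\phi_t)\Big), & i=j.\end{cases}$$ (1) For any pair of nodes $i\neq j$ and parameters $\epsilon,\delta\in(0,1)$, if $l=\left\lceil \frac{1}{(2+d_j)^2}\left(\frac{1}{2\epsilon^2}+\frac{2}{3\epsilon}\right)\log\frac{2}{\delta}\right\rceil$, then with probability at least $1-\delta$, $$\omega_{ij}-\epsilon\le\overline{\omega}_{ij}\le\omega_{ij}+\epsilon.$$ (2) For $i=j$ and parameters $\epsilon,\delta\in(0,1)$, if $l=\left\lceil\left(\frac{2}{3\epsilon}+\frac{1}{4\epsilon^2}\right)\log\frac{2}{\delta}\right\rceil$, then with probability at least $1-\delta$, $$(1-\epsilon)\,\omega_{ii}\le\overline{\omega}_{ii}\le(1+\epsilon)\,\omega_{ii}.$$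
   Context: $\mathcal{G}=(V,E)$ has $n$ nodes; $a_{ij}=1$ if $(i,j)\in E$ and $0$ otherwise. $d_i=\sum_j a_{ij}$ is the out-degree of $i$, $\mathbf{D}=\mathrm{diag}(d_1,\dots,d_n)$, $\mathbf{L}=\mathbf{D}-\mathbf{A}$, and the forest matrix is $\mathbf{\Omega}=(\mathbf{I}+\mathbf{L})^{-1}=(\omega_{ij})$. $N^-_j=\{k:(k,j)\in E\}$ is the set of in-neighbors of $j$. A rooted converging tree is a weakly connected digraph without cycles in which one node (the root) has out-degree $0$ and every other node has out-degree $1$ (an isolated node is such a tree rooted at itself). A spanning converging forest of $\mathcal{G}$ is a spanning subgraph (all of $V$, a subset of $E$) whose weakly connected components are rooted converging trees; $r_\phi(i)$ is the root of the tree of $\phi$ containing $i$. $\widehat{\omega}_{ij}(\phi)=\mathbb{I}_{\{r_\phi(i)=j\}}$ equals 1 if $r_\phi(i)=j$ and 0 otherwise. (The estimator $\overline{\omega}_{ij}$ is the output of the paper's algorithm SFQPlus on the sampled forests.) *)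

(* Defs.v *)
From HB Require Import structures.
From mathcomp Require Import all_boot all_order all_algebra.
From mathcomp Require Import all_classical all_reals all_analysis.

Set Implicit Arguments.
Unset Strict Implicit.
Unset Printing Implicit Defensive.

Import Order.TTheory GRing.Theory Num.Theory.
Local Open Scope ring_scope.

Section Forests.
Variable n : nat.
(* adjacency relation: a i j <=> (i,j) \in E *)
Variable a : rel 'I_n.

Definition outdeg (i : 'I_n) : nat := #|[set j | a i j]|.

Definition adjmx (R : realType) : 'M[R]_n := \matrix_(i, j) (a i j)%:R.
Definition degmx (R : realType) : 'M[R]_n := \matrix_(i, j) ((i == j)%:R * (outdeg i)%:R).
Definition lapmx (R : realType) : 'M[R]_n := degmx R - adjmx R.
Definition forestmx (R : realType) : 'M[R]_n := invmx (1%:M + lapmx R).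

(* A subgraph of G is given by its edge set F (its vertex set is all of V). *)
Definition edge_of (F : {set 'I_n * 'I_n}) : rel 'I_n := fun x y => (x, y) \in F.

Definition is_scf (F : {set 'I_n * 'I_n}) : bool :=
  [forall e in F, a e.1 e.2] &&
  [forall x, #|[set y | edge_of F x y]| <= 1]%N &&
  [forall x, forall y, edge_of F x y ==> ~~ connect (edge_of F) y x].

Definition forests : {set {set 'I_n * 'I_n}} := [set F | is_scf F].

Definition is_root (F : {set 'I_n * 'I_n}) (j : 'I_n) : bool :=
  [forall y, ~~ edge_of F j y].

(* hat omega_ij(F) = indicator that the root of the tree of F containing i is j,
   i.e. j is a root of F reachable from i along F *)
Definition omega_hat (R : realType) (F : {set 'I_n * 'I_n}) (i j : 'I_n) : R :=
  (connect (edge_of F) i j && is_root F j)%:R.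

Definition omega_bar (R : realType) (l : nat)
    (phi : {ffun 'I_l -> {set 'I_n * 'I_n}}) (i j : 'I_n) : R :=
  if i != j then
    l%:R^-1 * \sum_(t < l) ((2 + (outdeg j)%:R)^-1 *
        (omega_hat R (phi t) i j + \sum_(k | a k j) omega_hat R (phi t) i k))
  else
    l%:R^-1 * \sum_(t < l) ((1 + (outdeg i)%:R)^-1 *
        (1 + \sum_(k | a k i) omega_hat R (phi t) i k)).

(* probability of an event on l independent uniform samples from forests:
   uniform measure on the l-fold product forests^l *)
Definition prob_samples (R : realType) (l : nat)
    (P : {ffun 'I_l -> {set 'I_n * 'I_n}} -> bool) : R :=
  (#|[set phi : {ffun 'I_l -> {set 'I_n * 'I_n}} |
      [forall t, phi t \in forests] && P phi]|)%:R
  / ((#|forests| ^ l)%N)%:R.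

End Forests.

(* Main.v *)
(* Matrix-forest theorem: let P i j be the proportion of forests in which the
   root of i is j.  Fix i and group the forests by the forest F obtained after
   deleting the out-edge of i.  The group of F consists of F and of F + (i, k)
   for the out-neighbours k of i whose root in F is not i, and summing over one
   group gives (1 + d_i) P i j - \sum_(k | a i k) P k j = (i == j).  Hence
   P = (I + L)^-1, and P * (I + L) = I expresses omega_ij through the column
   identity on which the estimator is built.

   Concentration: roots being unique, the sampled quantity is, up to affine
   rescaling, a mean of Bernoulli variables of parameter p.  For i != j one has
   p = (2 + d_j) omega_ij and Hoeffding's inequality suffices (the term
   2 / (3 eps) is slack).  For i = j, 1 + p = (1 + d_i) omega_ii, and Bernstein's
   inequality is applied with the variance bound (1 + p)^2 / 8 instead of
   p (1 - p), which also avoids the degenerate cases p = 0 and p = 1. *)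
Require Import Defs.
From HB Require Import structures.
From mathcomp Require Import all_boot all_order all_algebra.
From mathcomp Require Import all_classical all_reals all_analysis.
From mathcomp Require Import ring lra.
Import Order.TTheory GRing.Theory Num.Theory.
Import numFieldNormedType.Exports.
Local Open Scope ring_scope.

Set Implicit Arguments.
Unset Strict Implicit.
Unset Printing Implicit Defensive.

(** * Spanning converging forests *)

Section ConvergingForests.
Variables (n : nat) (a : rel 'I_n).
Implicit Types (F : {set 'I_n * 'I_n}) (i j k x y z : 'I_n).

(** Out-degrees at most one, with no path from the head of an edge back to its tail, make each
    component a tree converging to its only node of out-degree 0. *)
Lemma forestsP F :
  reflect [/\ forall x y, (x, y) \in F -> a x y,
              forall x y z, (x, y) \in F -> (x, z) \in F -> y = z
            & forall x y, (x, y) \in F -> ~~ connect (edge_of F) y x]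
          (F \in forests a).
Proof.
rewrite inE; apply: (iffP andP) =>
  [[/andP[/forallP Fa /forallP F1] /forallP Fc]|[Fa F1 Fc]].
  split=> [x y Fxy|x y z Fxy Fxz|x y Fxy].
  - by have /implyP/(_ Fxy) := Fa (x, y).
  - by apply: (card_le1_eqP (F1 x)); rewrite inE.
  - by have /forallP/(_ y)/implyP := Fc x; apply.
split; last first.
  by apply/forallP => x; apply/forallP => y; apply/implyP; apply: Fc.
apply/andP; split; first by apply/forallP => -[x y]; apply/implyP => /Fa.
apply/forallP => x; apply/card_le1_eqP => y z; rewrite !inE => Fxy Fxz.
exact: F1 Fxz Fxy.
Qed.

Lemma edge_of_sub F1 F2 :
  F1 \subset F2 -> subrel (connect (edge_of F1)) (connect (edge_of F2)).
Proof.
by move=> /fintype.subsetP F12; apply: connect_sub => x y /F12 Fxy; apply: connect1.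
Qed.

Lemma set0_forests : finset.set0 \in forests a.
Proof. by apply/forestsP; split=> x y; rewrite ?inE // => z; rewrite inE. Qed.

(** A path using the new edge is cut before its first and after its last use of that edge. *)
Lemma connect_edgeU1 F i k x y :
  connect (edge_of ((i, k) |: F)) x y =
  connect (edge_of F) x y || connect (edge_of F) x i && connect (edge_of F) k y.
Proof.
apply/idP/idP => [/connectP[p]|]; last first.
  have sF := edge_of_sub (finset.subsetUr [set (i, k)]%SET F).
  case/orP=> [/sF//|/andP[/sF xi /sF ky]].
  apply: connect_trans xi (connect_trans _ ky).
  by apply: connect1; rewrite /edge_of setU11.
elim: p x => [|z p IHp] x /=; first by move=> _ ->; rewrite connect0.
case/andP=> xz /IHp{}IHp /IHp{IHp}.
move: xz; rewrite /edge_of => /setU1P[[-> ->]|Fxz].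
  by rewrite connect0 /= => /orP[->|/andP[_ ->]]; rewrite orbT.
have xz : connect (edge_of F) x z by apply: connect1.
case/orP=> [/(connect_trans xz)->//|/andP[zi ->]].
by rewrite (connect_trans xz zi) orbT.
Qed.

Lemma is_rootP F i : reflect (forall y, (i, y) \notin F) (is_root F i).
Proof. exact: forallP. Qed.

Lemma connect_root F i j : is_root F i -> connect (edge_of F) i j = (i == j).
Proof.
move=> /is_rootP Fi; apply/idP/eqP => [/connectP[[|y p] /=]|->] //.
by rewrite /edge_of (negPf (Fi y)).
Qed.

(** The path leaving [x] is forced, so two paths to roots agree step by step and stop together. *)
Lemma root_uniq F x j k : F \in forests a ->
  connect (edge_of F) x j -> is_root F j ->
  connect (edge_of F) x k -> is_root F k -> j = k.
Proof.
move=> /forestsP[_ F1 _] /connectP[p].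
elim: p x => [|y p IHp] x /=.
  by move=> _ -> xr; rewrite connect_root // => /eqP.
case/andP=> xy yp jE jr /connectP[[|z q] /=].
  by move=> _ -> /is_rootP/(_ y); rewrite [_ \in _]xy.
case/andP=> xz zq kE; apply: (IHp y) => //; apply/connectP; exists q => //.
  by rewrite (F1 _ _ _ xy xz).
by rewrite (F1 _ _ _ xy xz).
Qed.

(** Since [i] has no out-edge in [F], out-degrees stay at most one, and a cycle appears exactly when
    [k] already leads to [i]. *)
Lemma forestsU1 F i k : F \in forests a -> is_root F i ->
  ((i, k) |: F \in forests a) = a i k && ~~ connect (edge_of F) k i.
Proof.
move=> /forestsP[Fa F1 Fc] /is_rootP Fi; apply/idP/idP.
  case/forestsP=> Ga _ Gc; have ik : (i, k) \in (i, k) |: F by rewrite setU11.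
  rewrite (Ga _ _ ik) /=; apply: contra (Gc _ _ ik).
  exact: edge_of_sub (finset.subsetUr _ _) _ _.
case/andP=> aik nki; apply/forestsP; split=> [x y|x y z|x y].
- by case/setU1P=> [[-> ->]|/Fa].
- case/setU1P=> [[-> ->]|Fxy]; case/setU1P=> [[]|Fxz] //.
  + by rewrite (negPf (Fi z)) in Fxz.
  + by move=> xi; rewrite xi (negPf (Fi y)) in Fxy.
  + exact: F1 Fxy Fxz.
- rewrite connect_edgeU1 => /setU1P[[-> ->]|Fxy]; first by rewrite (negPf nki).
  rewrite (negPf (Fc _ _ Fxy)) /=; apply: contra nki => /andP[yi kx].
  by apply: connect_trans kx (connect_trans _ yi); apply: connect1.
Qed.

Lemma forestsD1 F i k : F \in forests a -> (i, k) \in F ->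
  (F :\ (i, k) \in forests a) && is_root (F :\ (i, k)) i.
Proof.
move=> /forestsP[Fa F1 Fc] ik; apply/andP; split.
  apply/forestsP; split=> [x y|x y z|x y]; rewrite !inE.
  - by case/andP=> _ /Fa.
  - by case/andP=> _ Fxy /andP[_ Fxz]; apply: F1 Fxy Fxz.
  - case/andP=> _ /Fc; apply: contra; apply: edge_of_sub; exact: subD1set.
apply/is_rootP => y; rewrite !inE; apply/negP => /andP[/eqP ne iy].
by apply: ne; rewrite (F1 _ _ _ ik iy).
Qed.

(** * Root indicators and their sums over forests *)

Variable R : realType.

Local Notation hat := (omega_hat R).

Lemma omega_hat_root F i j : is_root F i -> hat F i j = (i == j)%:R.
Proof.
move=> Fi; rewrite /omega_hat connect_root //.
by case: eqVneq => [<-|]; rewrite ?Fi.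
Qed.

Lemma omega_hat_to_root F k i : is_root F i ->
  hat F k i = (connect (edge_of F) k i)%:R.
Proof. by move=> Fi; rewrite /omega_hat Fi andbT. Qed.

Lemma omega_hatM F k i j : F \in forests a -> i != j ->
  hat F k i * hat F k j = 0.
Proof.
move=> FF ij; rewrite /omega_hat -natrM mulnb.
case: andP => // -[/andP[ki ri] /andP[kj rj]].
by rewrite (root_uniq FF ki ri kj rj) eqxx in ij.
Qed.

(** At most one term is nonzero, as roots are unique. This is what turns the sampled sums into
    Bernoulli variables. *)
Lemma sum_omega_hat F (A : pred 'I_n) i : F \in forests a ->
  \sum_(k | A k) hat F i k =
  [exists k, A k && (connect (edge_of F) i k && is_root F k)]%:R.
Proof.
move=> FF; case: existsP => [[k /andP[Ak ik]]|noroot].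
  rewrite (bigD1 k) //= {1}/omega_hat ik big1 ?addr0 // => k' /andP[_ kk'].
  rewrite /omega_hat; case: andP => // -[ik' rk'].
  by case/andP: ik => ik rk; rewrite (root_uniq FF ik' rk' ik rk) eqxx in kk'.
rewrite big1 // => k Ak; rewrite /omega_hat; case: (boolP (_ && _)) => // ik.
by case: noroot; exists k; rewrite Ak.
Qed.

(** The new edge redirects the nodes rooted at [i] to the root of [k]; all others keep their
    root. *)
Lemma omega_hatU1 F i k x j : F \in forests a -> is_root F i ->
    ~~ connect (edge_of F) k i -> i != j ->
  hat ((i, k) |: F) x j = hat F x j + hat F x i * hat F k j.
Proof.
move=> FF ri nki ij; rewrite /omega_hat connect_edgeU1 ri andbT.
have -> : is_root ((i, k) |: F) j = is_root F j.
  apply: eq_forallb => y; rewrite /edge_of !inE xpair_eqE.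
  by rewrite [j == i]eq_sym (negPf ij).
case rj: (is_root F j); last by rewrite !andbF mulr0 addr0.
rewrite !andbT; case xj: (connect _ x j); case xi: (connect _ x i) => //=.
- by rewrite (root_uniq FF xi ri xj rj) eqxx in ij.
- by rewrite mul0r addr0.
- by rewrite mul1r add0r.
- by rewrite mul0r addr0.
Qed.

Lemma omega_hatU1_eq0 F i k x : hat ((i, k) |: F) x i = 0.
Proof.
rewrite /omega_hat; case: is_rootP => [/(_ k)|_]; last by rewrite andbF.
by rewrite setU11.
Qed.

(* Grouping the forests according to the forest left after deleting the
   out-edge of i. *)
Lemma sum_forests_cut i (g : {set 'I_n * 'I_n} -> R) :
  \sum_(F in forests a) g F =
  \sum_(F in forests a | is_root F i)
     (g F + \sum_(k | a i k) (1 - hat F k i) * g ((i, k) |: F)).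
Proof.
rewrite big_split /= (bigID (fun F => is_root F i)) /=; congr (_ + _).
(* If [i] is not a root, exactly one edge leaves it; summing over that edge lets the sums be
   exchanged. *)
have one F : F \in forests a -> ~~ is_root F i ->
    g F = \sum_(k | (i, k) \in F) g F.
  move=> /forestsP[_ F1 _]; rewrite negb_forall => /existsP[k].
  rewrite negbK => ik; rewrite (big_pred1 k) // => y /=.
  by apply/idP/eqP => [iy|->//]; rewrite (F1 _ _ _ iy ik).
rewrite (eq_bigr (fun F => \sum_(k | (i, k) \in F) g F)); last first.
  by move=> F /andP[]; apply: one.
rewrite (exchange_big_dep predT) //= exchange_big /= [RHS]big_mkcond /=.
apply: eq_bigr => k _.
rewrite (reindex_onto (fun F => (i, k) |: F) (fun F => F :\ (i, k))); last first.
  by move=> F /andP[_ ik]; rewrite finset.setD1K.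
rewrite /= (eq_bigl (fun F => (F \in forests a) && is_root F i &&
    (a i k && ~~ connect (edge_of F) k i))); last first.
  move=> F; rewrite setU11 andbT; apply/idP/idP.
    case/andP=> /andP[GF _] /eqP FE.
    have /andP := forestsD1 GF (setU11 (i, k) F).
    rewrite FE => -[FF ri]; rewrite FF ri /=.
    by rewrite -forestsU1.
  case/andP=> /andP[FF ri] ok; rewrite forestsU1 // ok /=.
  apply/andP; split.
    apply/negP => /is_rootP/(_ k); by rewrite setU11.
  by rewrite setU1K //; move/is_rootP: ri; apply.
case aik: (a i k); last by rewrite big1 // => F; rewrite andbF.
(* As [i] is a root of [F], the factor [1 - hat F k i] indicates that the edge to [k] closes no
   cycle. *)
rewrite big_mkcondr /=; apply: eq_bigr => F /andP[FF ri].
rewrite omega_hat_to_root //; case: connect => /=.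
  by rewrite subrr mul0r.
by rewrite subr0 mul1r.
Qed.

Lemma sum_outdeg i (c : R) : \sum_(k | a i k) c = (outdeg a i)%:R * c.
Proof.
by rewrite sumr_const mulr_natl /outdeg cardsE.
Qed.

Lemma sum_omega_hat_laplace i j :
  \sum_(F in forests a)
     ((1 + (outdeg a i)%:R) * hat F i j - \sum_(k | a i k) hat F k j) =
  #|forests a|%:R * (i == j)%:R.
Proof.
transitivity (\sum_(F in forests a) (i == j)%:R : R); last first.
  by rewrite sumr_const mulr_natl.
rewrite (sum_forests_cut i) [RHS](sum_forests_cut i).
apply: eq_bigr => F /andP[FF ri]; set d := _%:R.
rewrite omega_hat_root //; case: (eqVneq i j) => [<-|ij] /=.
  (* Once an edge leaves [i], no node has root [i], so only [F] contributes on the left; the right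
     side is the size of the group. *)
  rewrite mulr1 [X in _ + X]big1 ?addr0; last first.
    move=> k _; rewrite omega_hatU1_eq0 big1 ?mulr0 ?subrr ?mulr0 //.
    by move=> *; rewrite omega_hatU1_eq0.
  under [X in _ = _ + X]eq_bigr do rewrite mulr1.
  by rewrite sumrB sum_outdeg -/d; ring.
rewrite mulr0 [X in _ = _ + X]big1 ?addr0; last by move=> k _; rewrite mulr0.
rewrite add0r.
set mi := \sum_(k | a i k) hat F k i; set mj := \sum_(k | a i k) hat F k j.
(* In this form the sum over [k] collapses to [mj], which cancels the contribution [- mj] of [F]
   itself. *)
have term k : a i k ->
    (1 - hat F k i) * ((1 + d) * hat ((i, k) |: F) i j
       - \sum_(k0 | a i k0) hat ((i, k) |: F) k0 j) =
    (1 + d - mi) * hat F k j - mj * (1 - hat F k i).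
  move=> aik; have [ki|nki] := boolP (connect (edge_of F) k i).
    have ki1 : hat F k i = 1 by rewrite omega_hat_to_root // ki.
    have kj0 : hat F k j = 0 by rewrite -(omega_hatM k FF ij) ki1 mul1r.
    by rewrite ki1 kj0; ring.
  rewrite omega_hat_to_root // (negPf nki).
  rewrite (eq_bigr (fun k0 => hat F k0 j + hat F k0 i * hat F k j)); last first.
    by move=> k0 _; rewrite omega_hatU1.
  rewrite big_split /= -mulr_suml -/mi -/mj omega_hatU1 //.
  rewrite (omega_hat_root i ri) (omega_hat_root j ri) eqxx (negPf ij) /=.
  ring.
rewrite (eq_bigr _ term) sumrB -!mulr_sumr sumrB sum_outdeg -/d -/mi -/mj; ring.
Qed.

Lemma card_forests_gt0 : (0 < #|forests a|)%N.
Proof. by apply/card_gt0P; exists finset.set0; apply: set0_forests. Qed.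

Lemma card_forests_neq0 : #|forests a|%:R != 0 :> R.
Proof. by rewrite pnatr_eq0 -lt0n card_forests_gt0. Qed.

(** * The Laplacian and the matrix-forest theorem *)

Lemma lapmx1_row (M : 'M[R]_n) i j :
  ((1%:M + lapmx a R) *m M) i j =
  (1 + (outdeg a i)%:R) * M i j - \sum_(k | a i k) M k j.
Proof.
rewrite mxE (eq_bigr (fun k => (i == k)%:R * ((1 + (outdeg a i)%:R) * M i j)
   - (a i k)%:R * M k j)); last first.
  move=> k _; rewrite !mxE; case: eqVneq => [->|_] /=; ring.
rewrite sumrB; congr (_ - _).
  rewrite (bigD1 i) //= eqxx mul1r big1 ?addr0 // => k ki.
  by rewrite eq_sym (negPf ki) mul0r.
rewrite [RHS]big_mkcond; apply: eq_bigr => k _.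
by case: (a i k); rewrite ?mul1r ?mul0r.
Qed.

Lemma lapmx1_col (M : 'M[R]_n) i j :
  (M *m (1%:M + lapmx a R)) i j =
  (1 + (outdeg a j)%:R) * M i j - \sum_(k | a k j) M i k.
Proof.
rewrite mxE (eq_bigr (fun k => (k == j)%:R * ((1 + (outdeg a j)%:R) * M i j)
   - (a k j)%:R * M i k)); last first.
  move=> k _; rewrite !mxE; case: eqVneq => [->|_] /=; ring.
rewrite sumrB; congr (_ - _).
  rewrite (bigD1 j) //= eqxx mul1r big1 ?addr0 // => k ki.
  by rewrite (negPf ki) mul0r.
rewrite [RHS]big_mkcond; apply: eq_bigr => k _.
by case: (a k j); rewrite ?mul1r ?mul0r.
Qed.

Lemma mul_lapmx_omega_hat :
  (1%:M + lapmx a R) *m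
    (\matrix_(i, j) ((\sum_(F in forests a) hat F i j) / #|forests a|%:R)) = 1%:M.
Proof.
apply/matrixP => i j; rewrite lapmx1_row !mxE.
under [X in _ - X]eq_bigr do rewrite mxE.
rewrite -mulr_suml mulrA -mulrBl exchange_big /= mulr_sumr -sumrB.
by rewrite sum_omega_hat_laplace mulrAC mulfV ?mul1r // card_forests_neq0.
Qed.

Lemma forestmxE i j :
  forestmx a R i j = (\sum_(F in forests a) hat F i j) / #|forests a|%:R.
Proof.
(* [invmx] is a genuine inverse only on units; the right inverse just found gives invertibility. *)
have [u _] := mulmx1_unit mul_lapmx_omega_hat.
have := congr1 (mulmx (invmx (1%:M + lapmx a R))) mul_lapmx_omega_hat.
by rewrite mulmxA mulVmx // mul1mx mulmx1 /forestmx => <-; rewrite mxE.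
Qed.

Lemma forestmx_col i j :
  (1 + (outdeg a j)%:R) * forestmx a R i j =
  (i == j)%:R + \sum_(k | a k j) forestmx a R i k.
Proof.
have [u _] := mulmx1_unit mul_lapmx_omega_hat.
have /matrixP/(_ i j) := mulVmx u; rewrite lapmx1_col [RHS]mxE => <-.
by rewrite subrK.
Qed.

End ConvergingForests.

(** * Moment generating functions of Bernoulli variables *)

Section ExponentialInequalities.
Variable R : realType.
Implicit Types x p q t v lam : R.

(** The mean value theorem applied twice gives [f x = f2 e * c * x] with [c] between 0 and [x], so
    [c * x] is nonnegative. *)
Lemma ge0_of_derive2_ge0 (f f1 f2 : R -> R) :
  (forall x, is_derive x 1 f (f1 x)) -> (forall x, is_derive x 1 f1 (f2 x)) ->
  f 0 = 0 -> f1 0 = 0 -> (forall x, 0 <= f2 x) -> forall x, 0 <= f x.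
Proof.
move=> df df1 f0 f10 f2ge0.
have cont (h h1 : R -> R) (dh : forall x, is_derive x 1 h (h1 x)) x y :
    {within `[x, y], continuous h}%classic.
  apply: derivable_within_continuous => z _; exact: (@ex_derive _ _ _ _ _ _ _ (dh z)).
move=> x; have [x0|x0|<-] := ltgtP 0 x; last by rewrite f0.
- have [c c0x] := MVT x0 (fun z _ => df z) (cont _ _ df _ _).
  move: c0x; rewrite in_itv /= => /andP[c0 _].
  have [e _] := MVT c0 (fun z _ => df1 z) (cont _ _ df1 _ _).
  rewrite f0 f10 !subr0 => -> ->.
  by rewrite !mulr_ge0 // ltW.
- have [c c0x] := MVT x0 (fun z _ => df z) (cont _ _ df _ _).
  move: c0x; rewrite in_itv /= => /andP[_ c0].
  have [e _] := MVT c0 (fun z _ => df1 z) (cont _ _ df1 _ _).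
  rewrite f0 f10 => fc fx.
  have f1c : f1 c = f2 e * c by lra.
  have -> : f x = f2 e * (c * x) by rewrite f1c in fx; lra.
  by rewrite mulr_ge0 // mulr_le0 // ltW.
Qed.

(** The difference has second derivative [f2], nonnegative because [1 - y <= expR (- y)]. *)
Lemma expR_le_rational x : (1 - x / 3) * (expR x - 1 - x) <= x ^+ 2 / 2.
Proof.
rewrite -subr_ge0.
pose f y := y ^+ 2 / 2 - (1 - y / 3) * (expR y - 1 - y) : R.
pose f1 y := y + (expR y - 1 - y) / 3 - (1 - y / 3) * (expR y - 1) : R.
pose f2 y := (1 - expR y * (1 - y)) / 3 : R.
suff : 0 <= f x by [].
apply: (@ge0_of_derive2_ge0 f f1 f2).
- move=> y; rewrite /f; apply: is_derive_eq; rewrite /f1 /=; rewrite /GRing.scale /=; by field.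
- move=> y; rewrite /f1; apply: is_derive_eq; rewrite /f2 /=; rewrite /GRing.scale /=; by field.
- by rewrite /f expR0; ring.
- by rewrite /f1 expR0; ring.
- move=> y; rewrite /f2 divr_ge0 // subr_ge0.
  by have := ler_wpM2l (expR_ge0 y) (expR_ge1Dx (- y)); rewrite -expRD subrr expR0.
Qed.

(** As [expR x - 1 - x] is nonnegative, [1 - x / 3] can be lowered to the positive [1 - lam / 3]
    before dividing. *)
Lemma expR_le_bernstein x lam : x <= lam -> 0 <= lam < 3 ->
  expR x <= 1 + x + x ^+ 2 / (2 * (1 - lam / 3)).
Proof.
move=> xl /andP[lam0 lam3].
have := expR_le_rational x; have := expR_ge1Dx x => e1 e2.
have l0 : 0 < 1 - lam / 3 by lra.
have -> : x ^+ 2 / (2 * (1 - lam / 3)) = (x ^+ 2 / 2) / (1 - lam / 3) by field; lra.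
have : (expR x - 1 - x) * (1 - lam / 3) <= x ^+ 2 / 2.
  apply: le_trans e2; rewrite mulrC; apply: ler_wpM2r; lra.
by rewrite -ler_pdivlMr //; lra.
Qed.

(** In the weighted sum of the two quadratic bounds the linear terms cancel, leaving
    [1 + p * q * K]. *)
Lemma bernoulli_mgf_bernstein p q v lam : 0 <= p -> 0 <= q -> p + q = 1 ->
    p * q <= v -> 0 <= lam < 3 ->
  p * expR (lam * q) + q * expR (- (lam * p)) <=
  expR (v * (lam ^+ 2 / (2 * (1 - lam / 3)))).
Proof.
move=> p0 q0 pq1 pqv /andP[l0 l3]; set K := lam ^+ 2 / _.
have l3' : 0 < 1 - lam / 3 by lra.
have K0 : 0 <= K by rewrite divr_ge0 ?sqr_ge0 // mulr_ge0 // ltW.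
have b1 : expR (lam * q) <= 1 + lam * q + q ^+ 2 * K.
  have -> : q ^+ 2 * K = (lam * q) ^+ 2 / (2 * (1 - lam / 3)) by rewrite /K; field; lra.
  by apply: expR_le_bernstein; rewrite ?l0 //; nra.
have b2 : expR (- (lam * p)) <= 1 - lam * p + p ^+ 2 * K.
  have -> : p ^+ 2 * K = (- (lam * p)) ^+ 2 / (2 * (1 - lam / 3)) by rewrite /K; field; lra.
  by apply: expR_le_bernstein; rewrite ?l0 //; nra.
apply: le_trans (expR_ge1Dx _).
apply: (@le_trans _ _ (1 + p * q * K)); last by rewrite lerD2l ler_wpM2r.
apply: (le_trans (lerD (ler_wpM2l p0 b1) (ler_wpM2l q0 b2))).
by have -> : q = 1 - p by [lra]; rewrite le_eqVlt; apply/orP; left; apply/eqP; ring.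
Qed.

(** With [D] the uncentred generating function, [f] is [y ^+ 2 / 8] minus the logarithm of the
    centred one; [f2] is nonnegative since [4 * x * q <= (q + x) ^+ 2] at [x = p * expR y]. *)
Lemma bernoulli_mgf_hoeffding p q lam : 0 <= p -> 0 <= q -> p + q = 1 ->
  p * expR (lam * q) + q * expR (- (lam * p)) <= expR (lam ^+ 2 / 8).
Proof.
move=> p0 q0 pq1.
pose D y := q + p * expR y : R.
have D0 y : 0 < D y.
  rewrite /D; have := expR_gt0 y; nra.
pose f y := y ^+ 2 / 8 + p * y - ln (D y) : R.
pose f1 y := y / 4 + p - p * expR y / D y : R.
pose f2 y := 1 / 4 - (p * expR y * q) / (D y) ^+ 2 : R.
have dD (y : R) : is_derive y 1 D (p * expR y).
  rewrite /D; apply: is_derive_eq; rewrite /GRing.scale /=; ring.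
have : 0 <= f lam.
  apply: (@ge0_of_derive2_ge0 f f1 f2).
  - move=> y; have := is_derive1_comp (is_derive1_ln (D0 y)) (dD y) => dl.
    rewrite /f; apply: is_derive_eq; rewrite /f1 /= /GRing.scale /=; field; exact: lt0r_neq0.
  - move=> y; have := is_deriveV (lt0r_neq0 (D0 y)) (dD y) => dv.
    rewrite /f1; apply: is_derive_eq; rewrite /f2 /= /GRing.scale /=.
    have -> : q = D y - p * expR y by rewrite /D; ring.
    field; exact: lt0r_neq0.
  - by rewrite /f /D expR0 mulr1 addrC [q + p]addrC pq1 ln1; ring.
  - by rewrite /f1 /D expR0 mulr1 [q + p]addrC pq1; by field.
  - move=> y; rewrite /f2 subr_ge0 ler_pdivrMr ?exprn_gt0 //.
    rewrite /D; have := sqr_ge0 (q - p * expR y); lra.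
rewrite /f subr_ge0 => le.
have : D lam <= expR (lam ^+ 2 / 8 + p * lam).
  by rewrite -[leLHS](lnK (D0 lam)) ler_expR.
rewrite expRD [p * lam]mulrC => h.
have -> : lam * q = lam - lam * p by have -> : q = 1 - p by [lra]; ring.
rewrite -(ler_pM2r (expR_gt0 (lam * p))); apply: le_trans h.
rewrite mulrDl -!mulrA -!expRD subrK addNr expR0 /D mulr1.
by rewrite addrC.
Qed.

Lemma expR_lnV_le (delta K : R) : 0 < delta -> ln (2 / delta) <= K ->
  2 * expR (- K) <= delta.
Proof.
move=> d0 le; have : expR (- K) <= expR (- ln (2 / delta)) by rewrite ler_expR lerN2.
rewrite [leRHS]expRN lnK ?posrE ?divr_gt0 // invf_div; lra.
Qed.

End ExponentialInequalities.

(** * Concentration for uniform samples *)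

Section UniformSampling.
Variables (R : realType) (T : finType) (S : {set T}) (l : nat).
Hypothesis S_gt0 : (0 < #|S|)%N.
Implicit Types (P Q : {ffun 'I_l -> T} -> bool) (X : T -> R) (b : pred T).

Local Notation ffun_onS := (@ffun_on_mem 'I_l T (mem S)).

(** The formula of [prob_samples] over an arbitrary finite set, so that bounds transfer by
    conversion. *)
Definition prob_unif P : R :=
  #|[set phi : {ffun 'I_l -> T} | [forall t, phi t \in S] && P phi]|%:R
  / (#|S| ^ l)%N%:R.

Lemma cardS_gt0 : 0 < #|S|%:R :> R.
Proof. by rewrite ltr0n. Qed.

Lemma prob_unifE P :
  prob_unif P = (\sum_(phi in ffun_onS) (P phi)%:R) / #|S|%:R ^+ l.
Proof.
rewrite /prob_unif natrX; congr (_ / _).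
rewrite -natr_sum -sum1_card; congr _%:R.
rewrite big_mkcond [RHS]big_mkcond /=; apply: eq_bigr => phi _.
rewrite inE; have -> : [forall t, phi t \in S] = (phi \in ffun_onS).
  by apply/forallP/ffun_onP.
by case: (phi \in _); case: (P phi).
Qed.

(** Independence of the samples, as distributivity of products over sums. *)
Lemma sum_prod_ffun_on X :
  \sum_(phi in ffun_onS) \prod_(t < l) X (phi t) =
  (\sum_(x in S) X x) ^+ l.
Proof.
by rewrite -(bigA_distr_big (mem S) (fun _ => X)) prodr_const card_ord.
Qed.

(** The two events cover all samples, so their probabilities add up to at least 1. *)
Lemma prob_unif_ge P Q (delta : R) :
  (forall phi : {ffun 'I_l -> T}, (forall t, phi t \in S) -> ~~ P phi -> Q phi) ->
  prob_unif Q <= delta -> 1 - delta <= prob_unif P.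
Proof.
move=> PQ; rewrite lerBlDr => Qd.
apply: le_trans (lerD (lexx _) Qd); rewrite !prob_unifE -mulrDl -big_split /=.
rewrite ler_pdivlMr ?exprn_gt0 ?cardS_gt0 // mul1r.
rewrite -[#|S|%:R]sumr_const -sum_prod_ffun_on.
apply: ler_sum => phi /ffun_onP Sphi; rewrite big1 // -natrD ler1n.
have := PQ phi Sphi; case: (P phi) => //= -> //.
Qed.

(** Two-sided Chernoff bound: the indicator of the deviation is at most [E] times the sum of the
    exponentials at [lam] and [- lam]. *)
Lemma prob_unif_deviation X (c lam t : R) : 0 <= lam ->
  \sum_(x in S) expR (lam * X x) <= #|S|%:R * expR c ->
  \sum_(x in S) expR (- lam * X x) <= #|S|%:R * expR c ->
  prob_unif (fun phi : {ffun 'I_l -> T} => l%:R * t < `|\sum_(s < l) X (phi s)|) <=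
  2 * expR (- (l%:R * (lam * t - c))).
Proof.
move=> lam0 le1 le2; have N0 := cardS_gt0.
rewrite prob_unifE ler_pdivrMr ?exprn_gt0 //.
have mgf_le u : \sum_(x in S) expR (u * X x) <= #|S|%:R * expR c ->
    \sum_(phi in ffun_onS) expR (u * \sum_(s < l) X (phi s)) <=
    #|S|%:R ^+ l * expR (l%:R * c).
  move=> le; under eq_bigr do rewrite mulr_sumr expR_sum.
  rewrite (sum_prod_ffun_on (fun x => expR (u * X x))).
  rewrite expRM_natl -exprMn.
  by rewrite lerXn2r ?nnegrE ?mulr_ge0 ?expR_ge0 ?sumr_ge0 // => x _; apply: expR_ge0.
have := lerD (mgf_le _ le1) (mgf_le _ le2); rewrite -big_split /=.
set E := expR (- (l%:R * (lam * t))).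
have E0 : 0 <= E by apply: expR_ge0.
move/(ler_wpM2l E0) => le; apply: le_trans (le_trans _ le) _.
  rewrite mulr_sumr; apply: ler_sum => phi _; rewrite mulrDr -!expRD.
  case: ltP => [|_]; last by rewrite addr_ge0 ?expR_ge0.
  rewrite lter_normr => /orP[] /ltW lt.
  - apply: ler_wpDr; first exact: expR_ge0.
    by rewrite -[leLHS]expR0 ler_expR; nra.
  - apply: ler_wpDl; first exact: expR_ge0.
    by rewrite -[leLHS]expR0 ler_expR; nra.
have -> : - (l%:R * (lam * t - c)) = - (l%:R * (lam * t)) + l%:R * c by ring.
by rewrite [in leRHS]expRD -/E le_eqVlt; apply/orP; left; apply/eqP; ring.
Qed.

(** * Tail bounds for Bernoulli samples *)

Definition freq b : R := (\sum_(x in S) (b x)%:R) / #|S|%:R.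

Lemma freq_ge0 b : 0 <= freq b.
Proof. by rewrite divr_ge0 ?sumr_ge0. Qed.

Lemma freq_le1 b : freq b <= 1.
Proof.
rewrite ler_pdivrMr ?cardS_gt0 // mul1r -sumr_const.
by apply: ler_sum => x _; rewrite lern1 leq_b1.
Qed.

Lemma sum_expR_indicator b (lam : R) :
  \sum_(x in S) expR (lam * ((b x)%:R - freq b)) =
  #|S|%:R * (freq b * expR (lam * (1 - freq b)) +
             (1 - freq b) * expR (- (lam * freq b))).
Proof.
set p := freq b; set u := expR _; set v := expR _.
have Np : #|S|%:R * p = \sum_(x in S) (b x)%:R.
  by rewrite mulrC divfK // lt0r_neq0 // cardS_gt0.
rewrite (eq_bigr (fun x => (b x)%:R * (u - v) + v)); last first.
  move=> x _; case: (b x) => /=; first by rewrite mul1r subrK.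
  by rewrite mul0r !add0r mulrN.
rewrite big_split /= -mulr_suml -Np sumr_const -mulr_natl; ring.
Qed.

Lemma prob_unif_hoeffding b (t : R) : 0 <= t ->
  prob_unif (fun phi : {ffun 'I_l -> T} =>
    l%:R * t < `|\sum_(s < l) ((b (phi s))%:R - freq b)|) <=
  2 * expR (- (l%:R * (2 * t ^+ 2))).
Proof.
move=> t0; have p0 := freq_ge0 b; have := freq_le1 b; rewrite -subr_ge0 => q0.
(* [lam = 4 * t] maximises the exponent [lam * t - lam ^+ 2 / 8]. *)
have -> : 2 * t ^+ 2 = (4 * t) * t - (4 * t) ^+ 2 / 8 by field.
apply: (prob_unif_deviation (X := fun x => (b x)%:R - freq b)); first by lra.
- rewrite sum_expR_indicator ler_wpM2l //.
  by apply: bernoulli_mgf_hoeffding; lra.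
(* The lower tail is the upper one with the parameters [p] and [1 - p] exchanged. *)
- rewrite sum_expR_indicator ler_wpM2l // addrC !mulNr opprK.
  have := @bernoulli_mgf_hoeffding _ (1 - freq b) (freq b) (4 * t) q0 p0.
  by rewrite subrK; apply.
Qed.

Lemma prob_unif_bernstein b (v t : R) : 0 <= t -> 0 < v ->
  freq b * (1 - freq b) <= v ->
  prob_unif (fun phi : {ffun 'I_l -> T} =>
    l%:R * t < `|\sum_(s < l) ((b (phi s))%:R - freq b)|) <=
  2 * expR (- (l%:R * (t ^+ 2 / (2 * (v + t / 3))))).
Proof.
move=> t0 v0 pqv; have p0 := freq_ge0 b.
have := freq_le1 b; rewrite -subr_ge0 => q0.
(* This choice gives [1 - lam / 3 = v / (v + t / 3)], which is positive and simplifies the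
   exponent. *)
pose lam := t / (v + t / 3); have w0 : 0 < v + t / 3 by lra.
have lam03 : 0 <= lam < 3.
  by rewrite /lam divr_ge0 ?(ltW w0) //= ltr_pdivrMr //; lra.
have -> : t ^+ 2 / (2 * (v + t / 3)) =
    lam * t - v * (lam ^+ 2 / (2 * (1 - lam / 3))).
  by rewrite /lam; field; rewrite !lt0r_neq0 //; lra.
apply: (prob_unif_deviation (X := fun x => (b x)%:R - freq b)).
- by case/andP: lam03.
- rewrite sum_expR_indicator ler_wpM2l //.
  by apply: bernoulli_mgf_bernstein => //; lra.
- rewrite sum_expR_indicator ler_wpM2l // addrC !mulNr opprK.
  have := @bernoulli_mgf_bernstein _ (1 - freq b) (freq b) v lam q0 p0.
  by rewrite subrK [_ * freq b]mulrC; apply.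
Qed.

End UniformSampling.

(** * From the sample sizes to the error guarantees *)

Lemma ceil_pos_le (R : realType) (l : nat) (x : R) :
  l%:Z = Num.ceil x -> 0 < x -> 0 < l%:R :> R /\ x <= l%:R.
Proof.
move=> lE x0; have : x <= l%:R.
  by rewrite -[l%:R]/(l%:Z%:~R) lE; apply: Num.Theory.ceil_ge.
by move=> xl; split=> //; apply: lt_le_trans xl.
Qed.

Lemma dist_mean_le (R : realType) (l : nat) (X : 'I_l -> R) (p t : R) :
  0 < l%:R :> R -> `|\sum_(s < l) (X s - p)| <= l%:R * t ->
  `|l%:R^-1 * \sum_(s < l) X s - p| <= t.
Proof.
move=> l0; rewrite sumrB sumr_const card_ord -[p *+ l]mulr_natl.
have -> : \sum_(s < l) X s - l%:R * p = l%:R * (l%:R^-1 * \sum_(s < l) X s - p).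
  by rewrite mulrBr mulVKf // lt0r_neq0.
by rewrite normrM gtr0_norm // ler_pM2l.
Qed.

Theorem theorem4p5 (R : realType) (n : nat) (a : rel 'I_n)
    (simple : forall i : 'I_n, ~~ a i i) :
  (forall (i j : 'I_n), i != j ->
   forall (eps delta : R), 0 < eps < 1 -> 0 < delta < 1 ->
   forall l : nat,
     (l%:Z = Num.ceil (((2 + (outdeg a j)%:R) ^+ 2)^-1 *
                        ((2 * eps ^+ 2)^-1 + 2 / (3 * eps)) * ln (2 / delta))) ->
     1 - delta <= prob_samples a R (l:=l) (fun phi =>
        (forestmx a R i j - eps <= omega_bar a R phi i j) &&
        (omega_bar a R phi i j <= forestmx a R i j + eps)))
  /\
  (forall (i : 'I_n) (eps delta : R), 0 < eps < 1 -> 0 < delta < 1 ->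
   forall l : nat,
     (l%:Z = Num.ceil ((2 / (3 * eps) + (4 * eps ^+ 2)^-1) * ln (2 / delta))) ->
     1 - delta <= prob_samples a R (l:=l) (fun phi =>
        ((1 - eps) * forestmx a R i i <= omega_bar a R phi i i) &&
        (omega_bar a R phi i i <= (1 + eps) * forestmx a R i i))).
Proof.
have N0 := card_forests_gt0 a.
pose b (A : pred 'I_n) (i : 'I_n) (F : {set 'I_n * 'I_n}) :=
  [exists k, A k && (connect (edge_of F) i k && is_root F k)].
have freqE (A : pred 'I_n) (i : 'I_n) :
    freq R (forests a) (b A i) = \sum_(k | A k) forestmx a R i k.
  under [RHS]eq_bigr do rewrite forestmxE.
  rewrite -mulr_suml exchange_big /=; congr (_ / _).
  by apply: eq_bigr => F FF; rewrite (sum_omega_hat R A i FF).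
have ln0 (delta : R) : 0 < delta < 1 -> 0 < ln (2 / delta).
  by case/andP=> d0 d1; rewrite ln_gt0 // ltr_pdivlMr //; lra.
split=> [i j ij|i] eps delta /andP[e0 e1] d01 l lE;
  have L0 := ln0 _ d01; have /andP[d0 _] := d01.
- set d : R := (outdeg a j)%:R in lE *.
  have dd : 0 < 2 + d by rewrite ltr_wpDr.
  (* The estimator asks whether the root of [i] lies in this set; [simple] keeps [j] from being
     counted twice. *)
  pose A (k : 'I_n) := (k == j) || a k j.
  have sumA (f : 'I_n -> R) : \sum_(k | A k) f k = f j + \sum_(k | a k j) f k.
    rewrite (bigD1 j) /A ?eqxx //=; congr (_ + _); apply: eq_bigl => k.
    by case: eqVneq => [->|] /=; rewrite ?andbF ?andbT // (negPf (simple j)).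
  have wE : (2 + d) * forestmx a R i j = freq R (forests a) (b A i).
    rewrite freqE sumA; have := forestmx_col a R i j.
    by rewrite (negPf ij) add0r -/d => <-; ring.
  have [l0 le_l] : 0 < l%:R :> R /\
      ((2 + d) ^+ 2)^-1 * ((2 * eps ^+ 2)^-1 + 2 / (3 * eps)) * ln (2 / delta)
        <= l%:R.
    apply: ceil_pos_le => //; rewrite !mulr_gt0 ?invr_gt0 ?exprn_gt0 //.
    by rewrite addr_gt0 ?divr_gt0 ?invr_gt0 ?mulr_gt0 ?exprn_gt0.
  (* The estimator is a Bernoulli mean divided by [2 + d], so an error [eps] is a deviation
     [(2 + d) * eps] of that mean. *)
  have t0 : 0 <= (2 + d) * eps by rewrite mulr_ge0 ?ltW.
  apply: (prob_unif_ge N0 _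
    (le_trans (prob_unif_hoeffding l N0 (b A i) t0) (expR_lnV_le d0 _))).
    move=> phi phiF; rewrite -ler_distl ltNge; apply: contraNN => dev.
    rewrite /omega_bar ij -/d -(ler_pM2l dd).
    rewrite -[X in X * `|_|](gtr0_norm dd) -normrM mulrBr wE.
    apply: le_trans (dist_mean_le l0 dev).
    rewrite -mulr_sumr mulrCA mulVKf ?lt0r_neq0 //.
    under eq_bigr => s _ do
      rewrite -(sumA (omega_hat R (phi s) i)) (sum_omega_hat R A i (phiF s)).
    by [].
  have -> : l%:R * (2 * ((2 + d) * eps) ^+ 2) =
      l%:R * ((2 + d) ^+ 2 * (2 * eps ^+ 2)) by ring.
  have w0 : 0 < (2 + d) ^+ 2 * (2 * eps ^+ 2) by rewrite !mulr_gt0 ?exprn_gt0.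
  rewrite -ler_pdivrMr //; apply: le_trans le_l.
  rewrite mulrC ler_pM2r // invfM ler_pM2l ?invr_gt0 ?exprn_gt0 //.
  by rewrite lerDl divr_ge0 ?mulr_ge0 ?ltW.
- set d : R := (outdeg a i)%:R.
  have dd : 0 < 1 + d by rewrite ltr_wpDr.
  pose A (k : 'I_n) := a k i; pose p := freq R (forests a) (b A i).
  have p0 : 0 <= p := freq_ge0 _ _ _.
  have wE : (1 + d) * forestmx a R i i = 1 + p.
    by rewrite /p freqE forestmx_col eqxx.
  have [l0 le_l] : 0 < l%:R :> R /\
      (2 / (3 * eps) + (4 * eps ^+ 2)^-1) * ln (2 / delta) <= l%:R.
    apply: ceil_pos_le => //; rewrite mulr_gt0 //.
    by rewrite addr_gt0 ?divr_gt0 ?invr_gt0 ?mulr_gt0 ?exprn_gt0.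
  (* A relative error [eps] on [omega_ii], multiplied by [1 + d], becomes this deviation of the
     mean. *)
  have t0 : 0 <= eps * (1 + p) by rewrite mulr_ge0 ?addr_ge0 // ltW.
  (* [p (1 - p) / (1 + p)^2] is maximal at [p = 1/3], with value [1/8] *)
  have v0 : 0 < (1 + p) ^+ 2 / 8 by rewrite divr_gt0 ?exprn_gt0 //; lra.
  have pqv : p * (1 - p) <= (1 + p) ^+ 2 / 8.
    by have := sqr_ge0 (3 * p - 1); lra.
  apply: (prob_unif_ge N0 _
    (le_trans (prob_unif_bernstein l N0 t0 v0 pqv) (expR_lnV_le d0 _))).
    move=> phi phiF; rewrite mulrBl mul1r mulrDl mul1r -ler_distl ltNge.
    apply: contraNN => dev.
    rewrite /omega_bar eqxx /= -/d -(ler_pM2l dd) [leRHS]mulrCA wE.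
    rewrite -[X in X * `|_|](gtr0_norm dd) -normrM mulrBr wE.
    apply: le_trans (dist_mean_le l0 dev).
    rewrite -mulr_sumr mulrCA mulVKf ?lt0r_neq0 //.
    under eq_bigr => s _ do rewrite (sum_omega_hat R A i (phiF s)).
    (* The constant 1 of each summand averages to 1 and cancels the one in [1 + p]. *)
    rewrite big_split /= sumr_const card_ord mulrDr mulVf ?lt0r_neq0 //.
    by rewrite opprD addrACA subrr add0r.
  have q0 : 0 < 1 + p by lra.
  set K := _ / (2 * _).
  have K0 : 0 < K.
    by rewrite divr_gt0 ?exprn_gt0 ?mulr_gt0 // addr_gt0 // divr_gt0 ?mulr_gt0.
  rewrite -ler_pdivrMr //; apply: le_trans le_l; rewrite mulrC ler_pM2r //.
  (* The factor 1/8 in the variance bound yields [(4 * eps ^+ 2)^-1]; the other term is at most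
     [2 / (3 * eps)] as [1 + p >= 1]. *)
  have -> : K^-1 = 2 / (3 * eps) / (1 + p) + (4 * eps ^+ 2)^-1.
    rewrite /K; field; rewrite !lt0r_neq0 //.
    by rewrite !addr_gt0 ?mulr_gt0 ?exprn_gt0.
  rewrite lerD2r ler_pdivrMr // ler_peMr ?lerDl //.
  by rewrite divr_ge0 ?mulr_ge0 // ltW.
Qed.
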